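(* Let $q>2$ be a prime power, let $G=\mathrm{SL}_n(\mathbb{F}_q)$ and let $S$ be a set of generators of $G$ with $I_n\in S=S^{-1}$. For $0<k<n$, let $V$ be the set of linearly independent $k$-tuples of vectors of $\mathbb{F}_q^n$, with $G$ acting by $A(v_1,\dots,v_k)=(Av_1,\dots,Av_k)$. Let $\mathfrak{X}_S$ be the configuration coming from the Schreier graph $\mathrm{Sch}(V,S)$, and let $p$ be the smallest prime dividing $q-1$. Then the number $WL(\mathfrak{X}_S)$ of nontrivial iterations of the Weisfeiler-Leman algorithm applied to $\mathfrak{X}_S$ satisfies $$WL(\mathfrak{X}_S)\geq \log_2\mathrm{diam}\,\mathrm{Sch}(V,S)-\log_2(p-1)-3 .$$
   Context: The Schreier graph $\mathrm{Sch}(V,S)$ has vertex set $V$ and (multi)edge set $\{(v,sv): v\in V, s\in S\}$; its diameter is the maximum over ordered pairs of vertices of the length of a shortest directed path between them. The configuration $\mathfrak{X}_S$ is the pair $(V,c)$ with colouring $c(v_1,v_2)=\{s\in S: sv_1=v_2\}\subseteq S$. Weisfeiler-Leman algorithm: for a set $\Gamma$ with colouring $c:\Gamma^2\to\mathcal{C}$, put $c^{(0)}=c$, $\mathcal{C}^{(0)}=\mathcal{C}$, and define $c^{(h+1)}(v_1,v_2)$ to be the tuple consisting of $c^{(h)}(v_1,v_2)$ together with the family of numbers $\left|\{w\in\Gamma: c^{(h)}(v_1,w)=c_1,\ c^{(h)}(w,v_2)=c_2\}\right|$ indexed by $(c_1,c_2)\in\mathcal{C}^{(h)}\times\mathcal{C}^{(h)}$;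 $\mathcal{C}^{(h+1)}$ is the set of values of $c^{(h+1)}$. The number of nontrivial iterations $WL$ is the least $h\geq0$ such that the partition of $\Gamma^2$ into colour classes of $c^{(h+1)}$ equals that of $c^{(h)}$. *)

(* Defs.v *)
From HB Require Import structures.
From mathcomp Require Import all_boot all_order all_algebra all_fingroup.
From mathcomp Require Import reals exp.

Set Implicit Arguments.
Unset Strict Implicit.
Unset Printing Implicit Defensive.

Import Order.TTheory GRing.Theory Num.Theory.

Section Distance.
Variables (V : finType) (e : rel V).

Definition has_walk (v w : V) (d : nat) : bool :=
  [exists p : d.-tuple V, path e v p && (last v p == w)].

(* The least d such that has_walk v w d. A shortest path has fewer than #|V|
   edges, so searching d < #|V| loses nothing; the value is #|V| exactly when
   w is unreachable from v. *)
Definition dist (v w : V) : nat := find (has_walk v w) (iota 0 #|V|).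

Definition diam : nat := \max_(v : V) \max_(w : V) dist v w.

End Distance.

Section Schreier.
Variables (gT : finGroupType) (V : finType) (act : gT -> V -> V).

Definition Sch (S : {set gT}) : rel V :=
  fun v w => [exists s in S, act s v == w].

Definition Sch_colour (S : {set gT}) (x : V * V) : {set gT} :=
  [set s in S | act s x.1 == x.2].

End Schreier.

Section WeisfeilerLeman.
Variables (V C : finType) (c : V * V -> C).

(* The families of intersection numbers are indexed by all pairs of elements
   of the ambient colour type; colours that are not attained only contribute
   entries equal to 0. The counts are at most #|V|, so they live in
   'I_#|V|.+1, which keeps every colour type finite. *)
Fixpoint WL_type (h : nat) : finType :=
  if h is h'.+1 then
    (WL_type h' * {ffun WL_type h' * WL_type h' -> 'I_#|V|.+1})%type
  else C.

Definition WL_count (D : finType) (d : V * V -> D) (x : V * V) (a : D * D)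
    : 'I_#|V|.+1 :=
  Ordinal (max_card [set w : V | (d (x.1, w) == a.1) && (d (w, x.2) == a.2)]
             : #|_| < #|V|.+1).

Fixpoint WL_colour (h : nat) : V * V -> WL_type h :=
  if h is h'.+1 then
    fun x => (WL_colour h' x, [ffun a => WL_count (WL_colour h') x a])
  else c.

Definition WL_partition (h : nat) : {set {set V * V}} :=
  preim_partition (WL_colour h) [set: V * V].

Let WL_eq (h : nat) : {set (V * V) * (V * V)} :=
  [set xy | WL_colour h xy.1 == WL_colour h xy.2].

Lemma WL_stabilizes : exists h, WL_partition h.+1 == WL_partition h.
Proof.
have sub h : WL_eq h.+1 \subset WL_eq h.
  by apply/subsetP=> x; rewrite !inE => /eqP /= [-> _].
have stab h : WL_eq h.+1 = WL_eq h -> WL_partition h.+1 == WL_partition h.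
  move=> E; apply/eqP; apply: eq_imset => x; apply/setP=> y; rewrite !inE /=.
  by have /setP/(_ (x, y)) := E; rewrite !inE.
have [h /eqP Eh|H] := pickP
  (fun h : 'I_(#|WL_eq 0|.+1) => WL_eq h.+1 == WL_eq h).
  by exists h; exact: stab.
suff /(_ #|WL_eq 0|.+1 (leqnn _)): forall h, h <= #|WL_eq 0|.+1 ->
    #|WL_eq h| + h <= #|WL_eq 0| by rewrite addnS ltnNge leq_addl.
elim=> [|h IH] le_h; first by rewrite addn0.
apply: leq_trans (IH (ltnW le_h)); rewrite addnS -addSn leq_add2r.
by apply: proper_card; rewrite properEneq sub (negbT (H (Ordinal le_h))).
Qed.

Definition WL : nat := ex_minn WL_stabilizes.

End WeisfeilerLeman.

(* {'GL_n[F]} consists of matrices of size n.-1.+1, which is n when 0 < n. *)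
Section SpecialLinear.
Variables (F : finFieldType) (n k : nat).

Definition SL : {set {'GL_n[F]}} := [set A | (\det (GLval A) == 1)%R].

Definition free_tuple : finType :=
  {v : k.-tuple 'cV[F]_n.-1.+1 | free v}.

Lemma free_mulmx (A : {'GL_n[F]}) (v : free_tuple) :
  free (map_tuple (mulmx (GLval A)) (val v)).
Proof.
apply/freeP=> a a0; have /freeP := valP v; apply.
apply: (can_inj (mulKmx (GL_unitmx A))); rewrite mulmx0 -[RHS]a0 mulmx_sumr.
apply: eq_bigr => i _; rewrite -scalemxAr; congr (_ *: _)%R.
by rewrite (nth_map 0%R) ?size_tuple.
Qed.

Definition SL_act (A : {'GL_n[F]}) (v : free_tuple) : free_tuple :=
  Sub (map_tuple (mulmx (GLval A)) (val v)) (free_mulmx A v).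

End SpecialLinear.

Arguments SL F n : clear implicits.

Definition log2 (R : realType) (x : R) : R := (ln x / ln 2)%R.

(* Main.v *)
Require Import Defs.
From HB Require Import structures.
From mathcomp Require Import all_boot all_order all_algebra all_fingroup.
From mathcomp Require Import reals exp.

(* Two vertices are called near at level h if some product of 2^h elements of S
   maps the first to the second.  A scalar matrix commutes with S, so it acts on
   V by automorphisms of the configuration.  By induction on h, two far pairs
   (x, y) and (a x, b y), with a and b scalar, have the same colour at level h:
   within every scalar orbit, the vertices near x and those near y are moved by
   a and b respectively, and there remain as many vertices far from both ends
   for one pair as for the other.  But the stable colour of (x, y) determines
   the set of g in G with g x = y, so once the colouring is stable, at radius
   r = 2^WL, every x is near y or near l y for a fixed scalar l <> 1.  Hence the
   ball B of radius r at x and its translate by 1/l cover the connected graph;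
   an edge joining them gives d(x, x/l) <= 2r + 1, so the diameter is at most
   3r + 1 <= 4r. *)

Set Implicit Arguments.
Unset Strict Implicit.
Unset Printing Implicit Defensive.

Import Order.TTheory GRing.Theory Num.Theory.

(** * Stability of the colour partition persists at all later levels *)

Section StableColouring.
Variables (V C : finType) (c : V * V -> C).
Local Notation col := (WL_colour c).

Lemma WL_partition_eqP h :
  WL_partition c h.+1 = WL_partition c h ->
  forall x y, col h x = col h y -> col h.+1 x = col h.+1 y.
Proof.
move=> eq_part x y exy; apply/eqP.
have eqR m : {in [set: V * V] & &, equivalence_rel
    (fun u v => col m u == col m v)}.
  by move=> u v w _ _ _; split=> // /eqP ->.
rewrite -(pblock_equivalence_partition (eqR h.+1)) ?inE //.
move: eq_part; rewrite /WL_partition /preim_partition => ->.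
by rewrite (pblock_equivalence_partition (eqR h)) ?inE //; apply/eqP.
Qed.

(** Under stability an attained colour of level [h.+1] has the same class as its first component, so
    the new intersection numbers are either 0 or intersection numbers of level [h], already recorded
    in the colour of level [h.+1]. *)
Lemma WL_colour_stableS h :
  (forall x y, col h x = col h y -> col h.+1 x = col h.+1 y) ->
  forall x y, col h.+1 x = col h.+1 y -> col h.+2 x = col h.+2 y.
Proof.
move=> stab x y exy.
have attained (a : WL_type V C h.+1) :
    (forall u, (col h.+1 u == a) = (col h u == a.1)) \/
    (forall u, (col h.+1 u == a) = false).
  have [v /eqP <-|no] := pickP (fun v => col h.+1 v == a); last by right.
  left=> u; apply/eqP/eqP => [[]|/stab] //.
have counts : [ffun a => WL_count (col h) x a] = [ffun a => WL_count (col h) y a].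
  by case: exy.
have -> z : col h.+2 z = (col h.+1 z, [ffun a => WL_count (col h.+1) z a]) by [].
rewrite exy; congr pair; apply/ffunP=> -[a1 a2]; rewrite !ffunE; apply: val_inj.
rewrite [LHS]/= [RHS]/=.
case: (attained a1) => e1; last by rewrite !eq_card0 // => w; rewrite !inE e1.
case: (attained a2) => e2; last first.
  by rewrite !eq_card0 // => w; rewrite !inE e2 andbF.
have /ffunP/(_ (a1.1, a2.1)) := counts; rewrite !ffunE => /(congr1 val) /= E.
by apply: etrans (etrans E _); apply: eq_card => w; rewrite !inE e1 e2.
Qed.

Lemma WL_colour_stable x y m :
  col (WL c) x = col (WL c) y -> col (WL c + m) x = col (WL c + m) y.
Proof.
move=> exy; have stab : forall k u v,
    col (WL c + k) u = col (WL c + k) v -> col (WL c + k).+1 u = col (WL c + k).+1 v.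
  elim=> [|k IH].
    rewrite addn0; apply: WL_partition_eqP; apply/eqP.
    by rewrite /WL; case: ex_minnP.
  by rewrite addnS; apply: WL_colour_stableS.
elim: m => [|m IH]; first by rewrite addn0.
by rewrite addnS; apply: stab.
Qed.

End StableColouring.

(** * Counting in a group cut into two pieces that are translated separately *)

Section ShiftCount.
Local Open Scope group_scope.
Variables (gT : finGroupType) (Z : {group gT}).

Lemma card_lcoset_shift (P A A' : {set gT}) a :
    {in P, forall z, (z \in A) = (a * z \in A')} ->
  #|A' :&: a *: P| = #|A :&: P|.
Proof.
move=> AA'; rewrite -(card_lcoset (A :&: P) a); apply: eq_card => z.
rewrite !inE !mem_lcoset !inE; have [Pz|] := boolP (_ \in P); last by rewrite !andbF.
by rewrite !andbT (AA' _ Pz) mulKVg.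
Qed.

(** [A] and [A'] correspond on [P] and [Q] through translation by [a] and [b]. The two remainders of
    [Z] have equal size, and on them [A] and [A'] are both everything or both empty. *)
Lemma card_two_shifts (P Q A A' : {set gT}) a b :
    a \in Z -> b \in Z -> P \subset Z -> Q \subset Z ->
    [disjoint P & Q] -> [disjoint a *: P & b *: Q] ->
    A \subset Z -> A' \subset Z ->
    {in P, forall z, (z \in A) = (a * z \in A')} ->
    {in Q, forall z, (z \in A) = (b * z \in A')} ->
    {in Z :\: (P :|: Q) & Z :\: (a *: P :|: b *: Q),
       forall z z', (z \in A) = (z' \in A')} ->
  #|A| = #|A'|.
Proof.
move=> Za Zb sPZ sQZ dPQ dPQ' sAZ sAZ' hP hQ hD.
have split (B X Y : {set gT}) : [disjoint X & Y] -> B \subset Z ->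
    #|B| = (#|B :&: X| + #|B :&: Y| + #|B :&: (Z :\: (X :|: Y))|)%N.
  move=> dXY sBZ; rewrite -[in LHS](cardsID (X :|: Y) B); congr (_ + _)%N.
    rewrite setIUr cardsU [X in (_ - X)%N](_ : _ = 0%N) ?subn0 //.
    apply/eqP; rewrite cards_eq0 -subset0 setIACA setIid.
    by move: dXY; rewrite -setI_eq0 => /eqP->; rewrite setI0 subxx.
  by rewrite setIDA (setIidPl sBZ).
rewrite (split A P Q) // (split A' (a *: P) (b *: Q)) //.
rewrite (card_lcoset_shift hP) (card_lcoset_shift hQ); congr (_ + _)%N.
set D := Z :\: _ in hD *; set D' := Z :\: _ in hD *.
have sa (X : {set gT}) c : c \in Z -> X \subset Z -> c *: X \subset Z.
  by move=> Zc sX; rewrite mul_subG ?sub1set.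
have eD : #|D| = #|D'|.
  have := split Z _ _ dPQ (subxx _); rewrite (split Z _ _ dPQ' (subxx _)).
  rewrite !(setIidPr _) ?sa ?subsetDl // !card_lcoset.
  by move/addnI=> ->.
(* An element of each remainder is needed to see that membership is constant there; as [D] and [D']
   have equal size, both are empty or neither is. *)
have [D0|[z Dz]] := set_0Vmem D.
  move: eD; rewrite D0 cards0 => /esym/cards0_eq ->.
  by rewrite !setI0.
have [z' Dz'] : exists z', z' \in D'.
  by apply/set0Pn; rewrite -cards_eq0 -eD cards_eq0; apply/set0Pn; exists z.
have [Az|nAz] := boolP (z \in A).
  rewrite !(setIidPr _) //; apply/subsetP=> t Dt; first by rewrite -(hD z t).
  by rewrite (hD t z') // -(hD z).
rewrite !eq_card0 // => t; rewrite inE; apply/negP=> /andP[At Dt].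
  by move: nAz; rewrite (hD z t) // At.
by move: nAz; rewrite (hD z z') // -(hD t z') // At.
Qed.

End ShiftCount.

(** * Colours and distances in a Schreier graph with a central group [Z] *)

Section SchreierGraph.
Local Open Scope group_scope.
Variables (gT : finGroupType) (V : finType) (act : gT -> V -> V).
Hypotheses (act1 : forall v, act 1 v = v)
           (actM : forall g h v, act (g * h) v = act g (act h v)).
Variable S : {set gT}.

Definition reach (d : nat) (x y : V) : bool :=
  [exists g in S ^+ d, act g x == y].

Local Notation col := (WL_colour (Sch_colour act S)).

Lemma act_inj g : injective (act g).
Proof. by apply: (can_inj (g := act g^-1)) => v; rewrite -actM mulVg. Qed.

Lemma reachP d x y :
  reflect (exists2 g, g \in S ^+ d & act g x = y) (reach d x y).
Proof.
by apply: (iffP exists_inP) => -[g Sg /eqP E]; exists g => //; apply/eqP.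
Qed.

Lemma reach_trans d e x y z : reach d x y -> reach e y z -> reach (d + e) x z.
Proof.
move=> /reachP[g Sg <-] /reachP[h Sh <-]; apply/reachP; exists (h * g) => //.
by rewrite addnC expgD mem_mulg.
Qed.

Lemma mem1_expgs d : 1 \in S -> 1 \in S ^+ d.
Proof.
move=> S1; elim: d => [|d IH]; first by rewrite set11.
by rewrite expgS -(mulg1 1) mem_mulg.
Qed.

Lemma reach_refl d x : 1 \in S -> reach d x x.
Proof. by move=> S1; apply/reachP; exists 1; rewrite ?mem1_expgs. Qed.

Lemma reach_leq d e x y : 1 \in S -> d <= e -> reach d x y -> reach e x y.
Proof.
move=> S1 /subnKC <- xy; exact: reach_trans xy (reach_refl _ _ S1).
Qed.

Lemma reach_sym d x y : S^-1 = S -> reach d x y -> reach d y x.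
Proof.
move=> SV /reachP[g Sg <-]; apply/reachP; exists g^-1; last first.
  by rewrite -actM mulVg act1.
have -> : S ^+ d = (S ^+ d)^-1.
  elim: d {Sg} => [|d IH]; first by rewrite invg1.
  by rewrite [in RHS]expgSr invMg -IH SV -expgS.
by rewrite memV_invg.
Qed.

Lemma reach1 x g : g \in S -> reach 1 x (act g x).
Proof. by move=> Sg; apply/reachP; exists g. Qed.

Lemma has_walk_reach d x y : reach d x y -> has_walk (Sch act S) x y d.
Proof.
move=> /reachP[g]; elim: d x g => [|d IH] x g.
  rewrite inE => /eqP -> <-; apply/existsP; exists [tuple].
  by rewrite /= act1 eqxx.
rewrite expgSr => /mulsgP[g' s Sg' Ss ->]; rewrite actM => gE.
have /existsP[p /andP[pp lp]] := IH _ _ Sg' gE.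
apply/existsP; exists [tuple of act s x :: p]; rewrite /= pp lp !andbT.
by apply/existsP; exists s; rewrite Ss eqxx.
Qed.

Lemma dist_reach d x y : reach d x y -> dist (Sch act S) x y <= d.
Proof.
move/has_walk_reach=> w; rewrite /dist.
have [le_Vd|lt_dV] := leqP #|V| d.
  by apply: leq_trans (find_size _ _) _; rewrite size_iota.
rewrite leqNgt; apply/negP=> /(before_find 0%N).
by rewrite nth_iota // add0n w.
Qed.

(** Split [g] as [g2 * g1] with both factors in [S ^+ (2 ^ h)]. The midpoint [act g1 x.1] makes an
    intersection number positive, so equal colours give a matching midpoint for [y], and induction
    applies to both halves. *)
Lemma WL_colour_transporter h x y g :
  g \in S ^+ (2 ^ h) -> col h x = col h y ->
  act g x.1 = x.2 -> act g y.1 = y.2.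
Proof.
elim: h x y g => [|h IH] [x1 x2] [y1 y2] g.
  rewrite expn0 expg1 => Sg /setP/(_ g); rewrite !inE /= Sg /= => E gx.
  by apply/eqP; rewrite -E; apply/eqP.
rewrite expnS mul2n -addnn expgD => /mulsgP[g2 g1 Sg2 Sg1 ->].
rewrite actM /= => -[_ /ffunP/(_ (col h (x1, act g1 x1), col h (act g1 x1, x2)))].
rewrite !ffunE => /(congr1 val) /= E gx; rewrite actM.
have : 0 < #|[set w | (col h (y1, w) == col h (x1, act g1 x1)) &&
                      (col h (w, y2) == col h (act g1 x1, x2))]|.
  by rewrite -E; apply/card_gt0P; exists (act g1 x1); rewrite inE !eqxx.
case/card_gt0P=> w; rewrite inE => /andP[/eqP/esym e1 /eqP/esym e2].
have /= -> := IH _ _ _ Sg1 e1 erefl.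
exact: IH _ _ _ Sg2 e2 gx.
Qed.

Variable Z : {group gT}.
Hypothesis cZS : Z \subset 'C(S).

Lemma act_central z g x : z \in Z -> g \in S -> act g (act z x) = act z (act g x).
Proof. by move=> Zz Sg; rewrite -!actM (centsP cZS z). Qed.

Lemma reach_central z d x y :
  z \in Z -> reach d (act z x) (act z y) = reach d x y.
Proof.
move=> Zz; apply: eq_existsb => g; have [Sg|//] := boolP (g \in S ^+ d).
rewrite -actM (_ : g * z = z * g) ?actM ?(inj_eq (@act_inj z)) //.
apply/esym; elim: d g Sg => [|d IH] g.
  by rewrite inE => /eqP ->; rewrite mulg1 mul1g.
rewrite expgS => /mulsgP[s g' Ss Sg' ->].
by rewrite mulgA (centsP cZS z Zz s Ss) -!mulgA IH.
Qed.

Lemma WL_colour_central z h x y :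
  z \in Z -> col h (act z x, act z y) = col h (x, y).
Proof.
move=> Zz; elim: h x y => [|h IH] x y.
  apply/setP=> s; rewrite !inE /=; have [Ss|//] := boolP (s \in S).
  by rewrite act_central // (inj_eq (@act_inj z)).
rewrite /= IH; congr pair; apply/ffunP=> a; rewrite !ffunE; apply: val_inj => /=.
rewrite -(card_preimset _ (@act_inj z)); apply: eq_card => w.
by rewrite !inE /= !IH.
Qed.

(** Double counting, which lets two subsets of [V] be compared one [Z]-orbit at a time. *)
Lemma sum_orbit_card (A : {set V}) :
  (\sum_w #|[set z in Z | act z w \in A]| = #|Z| * #|A|)%N.
Proof.
transitivity (\sum_w \sum_(z in Z) (act z w \in A : nat))%N.
  apply: eq_bigr => w _; rewrite -sum1_card [RHS]big_mkcond [LHS]big_mkcond /=.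
  by apply: eq_bigr => z _; rewrite !inE; case: (z \in Z); case: (_ \in A).
rewrite exchange_big /= -sum_nat_const; apply: eq_bigr => z _.
rewrite -(card_preimset A (@act_inj z)) -sum1_card [RHS]big_mkcond /=.
by apply: eq_bigr => w _; rewrite !inE; case: (_ \in A).
Qed.

Lemma WL_colour_far h x y a b :
    1 \in S -> a \in Z -> b \in Z ->
    ~~ reach (2 ^ h) x y -> ~~ reach (2 ^ h) (act a x) (act b y) ->
  col h (x, y) = col h (act a x, act b y).
Proof.
move=> S1 Za Zb; elim: h x y a b Za Zb => [|h IH] x y a b Za Zb far far'.
  have colour0 u v : ~~ reach (2 ^ 0) u v -> Sch_colour act S (u, v) = set0.
    move=> nuv; apply/setP=> s; rewrite !inE; apply/negP=> /andP[Ss /eqP /= suv].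
    by case/negP: nuv; apply/reachP; exists s; rewrite ?expn0.
  by rewrite /= !colour0.
(* Doubling the radius at each level ensures that no vertex is near both ends of a far pair. *)
have mid u v w : ~~ reach (2 ^ h.+1) u v ->
    reach (2 ^ h) u w -> ~~ reach (2 ^ h) w v.
  move=> nuv uw; apply: contra nuv => wv.
  by rewrite expnS mul2n -addnn; apply: reach_trans uw wv.
have le2 : 2 ^ h <= 2 ^ h.+1 by rewrite leq_exp2l.
have colh : col h (x, y) = col h (act a x, act b y).
  by apply: IH => //; [apply: contra far|apply: contra far']; apply: reach_leq.
rewrite /= -colh; congr pair; apply/ffunP=> -[c1 c2]; rewrite !ffunE.
apply: val_inj; rewrite [LHS]/= [RHS]/=.
set A := [set w | _]; set A' := [set w | _].
suff eqA w : #|[set z in Z | act z w \in A]| = #|[set z in Z | act z w \in A']|.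
  apply/eqP; rewrite -(eqn_pmul2l (cardG_gt0 Z)) -!sum_orbit_card.
  by apply/eqP; apply: eq_bigr.
pose P := [set z in Z | reach (2 ^ h) x (act z w)].
pose Q := [set z in Z | reach (2 ^ h) (act z w) y].
have Pa z : (z \in a *: P) = (z \in Z) && reach (2 ^ h) (act a x) (act z w).
  rewrite mem_lcoset inE groupMl ?groupV //; congr (_ && _).
  by rewrite -(reach_central _ _ _ Za) -actM mulKVg.
have Qb z : (z \in b *: Q) = (z \in Z) && reach (2 ^ h) (act z w) (act b y).
  rewrite mem_lcoset inE groupMl ?groupV //; congr (_ && _).
  by rewrite -(reach_central _ _ _ Zb) -actM mulKVg.
apply: (card_two_shifts Za Zb (P := P) (Q := Q)).
- by apply/subsetP=> z; rewrite inE => /andP[].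
- by apply/subsetP=> z; rewrite inE => /andP[].
- rewrite disjoints_subset; apply/subsetP=> z; rewrite !inE => /andP[_ xz].
  by rewrite negb_and (mid _ _ _ far xz) orbT.
- rewrite disjoints_subset; apply/subsetP=> z; rewrite Pa inE Qb => /andP[_ xz].
  by rewrite negb_and (mid _ _ _ far' xz) orbT.
- by apply/subsetP=> z; rewrite inE => /andP[].
- by apply/subsetP=> z; rewrite inE => /andP[].
(* For a vertex [act z w] near [x], moving by [a] keeps the first colour by centrality; the second
   leg is far for both pairs, so induction applies to it. *)
- move=> z; rewrite inE => /andP[Zz xz]; rewrite !inE groupM //= Zz /=.
  rewrite actM WL_colour_central // (IH (act z w) y a b) //; first exact: mid xz.
  by apply: mid far' _; rewrite reach_central.
- move=> z; rewrite inE => /andP[Zz zy]; rewrite !inE groupM //= Zz /=.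
  rewrite actM WL_colour_central // (IH x (act z w) a b) //.
    by apply: contraL zy; apply: mid far.
  by rewrite -(reach_central _ _ _ Zb) in zy; apply: contraL zy; apply: mid far'.
move=> z z'; rewrite !inE Pa Qb => /andP[+ Zz] /andP[+ Zz'].
rewrite Zz Zz' !negb_or /= => /andP[xz zy] /andP[xz' zy'].
(* Outside the shifted pieces all four legs are far, and [z' * z^-1] serves as the scalar moving one
   midpoint to the other. *)
have ezz : act (z' * z^-1) (act z w) = act z' w by rewrite -actM mulgKV.
rewrite (IH x (act z w) a (z' * z^-1)) ?groupM ?groupV ?ezz //.
by rewrite (IH (act z w) y (z' * z^-1) b) ?groupM ?groupV ?ezz.
Qed.

(** If both were far, [(x, y)] and [(x, act z y)] would share a stable colour, hence a colour at
    every later level, and [g] would map [x] to both [y] and [act z y]. *)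
Lemma WL_shift_near x y z :
    1 \in S -> z \in Z -> act z y <> y ->
    (exists2 g, g \in <<S>> & act g x = y) ->
  let r := (2 ^ WL (Sch_colour act S))%N in
  reach r x y || reach r x (act z y).
Proof.
move=> S1 Zz zy [g Sg gx] /=; apply: contraT; rewrite negb_or => /andP[n1 n2].
have [m defS] := gen_expgs S.
(* The level is raised until words of length [2 ^ _] cover all of [<<S>>], shorter words being
   padded with 1. *)
have Sgm : g \in S ^+ (2 ^ (WL (Sch_colour act S) + m)).
  rewrite defS in Sg; move: Sg; rewrite (setUidPr _) ?sub1set // => Sg.
  have le : m <= 2 ^ (WL (Sch_colour act S) + m).
    by apply: leq_trans (ltnW (ltn_expl _ _)) (leq_pexp2l _ (leq_addl _ _)).
  by rewrite -(subnKC le) expgD -(mulg1 g) mem_mulg ?mem1_expgs.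
have /= E := WL_colour_far S1 (group1 Z) Zz n1 _.
move: E; rewrite act1 => /(_ n2) /(WL_colour_stable m) E.
by have /= := WL_colour_transporter Sgm E gx; rewrite gx => /esym.
Qed.

Lemma diam_le_WL z :
    1 \in S -> S^-1 = S -> z \in Z -> (forall y, act z y <> y) ->
    (forall x y, exists2 g, g \in <<S>> & act g x = y) ->
  diam (Sch act S) <= 2 ^ (WL (Sch_colour act S)).+2.
Proof.
move=> S1 SV Zz zfree trans; set r := (2 ^ WL (Sch_colour act S))%N.
have near x y : reach r x y || reach r x (act z y) by apply: WL_shift_near.
have shift x : reach (r + (1 + r)) x (act z^-1 x).
  (* Either an edge leaves the ball of radius [r] at [x], and its far end lies in the translated
     ball, or the ball is closed under [S] and is all of [V] by transitivity. *)
  have [/existsP[y /exists_inP[s Ss /andP[xy nxsy]]]|closed] :=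
    boolP [exists y, exists s in S, reach r x y && ~~ reach r x (act s y)].
    have := near x (act s y); rewrite (negPf nxsy) /= => xzsy.
    apply: reach_trans xy (reach_trans (reach1 y Ss) _).
    apply: reach_sym => //; rewrite -(reach_central _ _ _ Zz).
    by rewrite -actM mulgV act1.
  apply: (@reach_leq r) => //; first exact: leq_addr.
  have [g + <-] := trans x (act z^-1 x).
  have [m ->] := gen_expgs S; rewrite (setUidPr _) ?sub1set //.
  elim: m g => [|m IH] g; first by rewrite inE => /eqP->; rewrite act1 reach_refl.
  rewrite expgS => /mulsgP[s g' Ss Sg' ->]; rewrite actM.
  apply: contraR closed => nsg; apply/existsP; exists (act g' x).
  by apply/exists_inP; exists s; rewrite // IH.
have r_gt0 : 0 < r by rewrite expn_gt0.
have all_near x y : reach (2 ^ (WL (Sch_colour act S)).+2) x y.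
  have -> : (2 ^ (WL (Sch_colour act S)).+2 = 4 * r)%N by rewrite !expnS mulnA.
  have /orP[xy|xzy] := near x y; first by apply: reach_leq xy; rewrite // leq_pmull.
  apply: (@reach_leq (r + (r + (1 + r)))) => //.
    by rewrite !mulSn mul0n addn0 !leq_add2l leq_add2r.
  by apply: reach_trans xzy _; have := shift (act z y); rewrite -actM mulVg act1.
by apply/bigmax_leqP=> x _; apply/bigmax_leqP=> y _; apply: dist_reach.
Qed.

End SchreierGraph.

(** * Transitivity of the special linear group and freeness of scalars on independent tuples *)

Section SpecialLinearAction.
Variables (F : finFieldType) (n k : nat).
Local Open Scope ring_scope.

Lemma SL_act1 (v : free_tuple F n k) : SL_act 1%g v = v.
Proof.
apply: val_inj; apply: val_inj => /=.
by rewrite -[RHS]map_id; apply: eq_map => u; rewrite mul1mx.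
Qed.

Lemma SL_actM (A B : {'GL_n[F]}) (v : free_tuple F n k) :
  SL_act (A * B)%g v = SL_act A (SL_act B v).
Proof.
apply: val_inj; apply: val_inj => /=.
by rewrite -map_comp; apply: eq_map => u /=; rewrite mulmxA.
Qed.

(** The vectors become rows, to match the row-space conventions of the matrix library; hence the
    transposes below. *)
Definition tuple_mx (v : free_tuple F n k) : 'M[F]_(k, n.-1.+1) :=
  \matrix_(i, j) tnth (val v) i j 0.

Lemma row_free_tuple_mx v : row_free (tuple_mx v).
Proof.
apply: inj_row_free => a av0; have /freeP free_v := valP v.
apply/rowP=> i; rewrite mxE; apply: (free_v (a 0)).
apply/colP=> j; have /rowP/(_ j) := av0; rewrite !mxE => <-.
by rewrite summxE; apply: eq_bigr => l _; rewrite !mxE (tnth_nth 0).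
Qed.

Lemma tuple_mx_act (A : {'GL_n[F]}) v :
  tuple_mx (SL_act A v) = tuple_mx v *m (GLval A)^T.
Proof.
apply/matrixP=> i j; rewrite !mxE tnth_map mxE.
by apply: eq_bigr => l _; rewrite !mxE mulrC.
Qed.

Lemma tuple_mx_inj : injective tuple_mx.
Proof.
move=> u v euv; apply: val_inj; apply: eq_from_tnth => i; apply/colP=> j.
by have /matrixP/(_ i j) := euv; rewrite !mxE.
Qed.

Lemma row_free_complete m (A B : 'M[F]_(k, m)) :
  row_free A -> row_free B -> {g | g \in unitmx & A *m g = B}.
Proof.
move=> fA fB; have [|g ug] := @complete_unitmx F _ _ A (pinvmx A *m B).
  by rewrite mulmxA mulmxVp // mul1mx (eqP fA) (eqP fB).
by rewrite mulmxA mulmxVp // mul1mx => eB; exists g.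
Qed.

(* The determinant is adjusted by a diagonal matrix acting on the last
   coordinate, which fixes the first k < n basis vectors. *)
Lemma SL_act_trans (x y : free_tuple F n k) :
  (k < n)%N -> exists2 A, A \in SL F n & SL_act A x = y.
Proof.
move=> lt_kn; have Nn : n.-1.+1 = n by rewrite prednK // (leq_ltn_trans _ lt_kn).
pose E : 'M[F]_(k, n.-1.+1) := pid_mx k.
have fE : row_free E by rewrite /row_free rank_pid_mx // Nn ltnW.
have [gx ux eX] := row_free_complete fE (row_free_tuple_mx x).
have [gy uy eY] := row_free_complete fE (row_free_tuple_mx y).
pose d := \det gx / \det gy.
pose D : 'M[F]_n.-1.+1 := diag_mx (\row_j if j == ord_max then d else 1).
have ED : E *m D = E.
  apply/matrixP=> i j; rewrite mul_mx_diag !mxE; have [ej|] := eqVneq j ord_max.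
    rewrite ej /= [(i == _ :> nat)]ltn_eqF ?mul0r //.
    by rewrite (leq_trans (ltn_ord i)) // -ltnS Nn.
  by rewrite mulr1.
have detD : \det D = d.
  rewrite det_diag (bigD1 ord_max) //= big1 ?mxE ?eqxx ?mulr1 //.
  by move=> j /negPf nj; rewrite mxE nj.
pose g := invmx gx *m D *m gy.
have dety : \det gy != 0 by rewrite -unitfE -unitmxE.
have detx : \det gx != 0 by rewrite -unitfE -unitmxE.
have detg : \det g = 1.
  rewrite !det_mulmx det_inv detD /d mulrA mulVf // mul1r.
  by rewrite mulVf.
have ug : g^T \in unitmx by rewrite unitmx_tr unitmxE detg unitr1.
exists (Sub g^T ug : {'GL_n[F]}).
  by rewrite inE; apply/eqP; rewrite /= det_tr.
apply: tuple_mx_inj; rewrite tuple_mx_act /= trmxK -eX /g !mulmxA mulmxK //.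
by rewrite ED.
Qed.

Lemma scalar_GL (l : F) : l != 0 ->
  {z : {'GL_n[F]} | GLval z = l%:M}.
Proof.
move=> l0; have ul : (l%:M : 'M[F]_n.-1.+1) \in unitmx.
  by rewrite unitmxE det_scalar unitrX // unitfE.
by exists (Sub l%:M ul).
Qed.

(** A fixed tuple would satisfy [(l - 1) *: tuple_mx v = 0], whereas [tuple_mx v] has rank
    [k > 0]. *)
Lemma SL_act_scalar_free (l : F) (z : {'GL_n[F]}) (v : free_tuple F n k) :
  (0 < k)%N -> l != 1 -> GLval z = l%:M -> SL_act z v <> v.
Proof.
move=> k_gt0 l1 ez /(congr1 tuple_mx).
rewrite tuple_mx_act ez tr_scalar_mx mul_mx_scalar => /eqP.
rewrite -[X in _ == X]scale1r -subr_eq0 -scalerBl scaler_eq0 subr_eq0 (negPf l1).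
move=> /eqP v0; have := row_free_tuple_mx v.
by rewrite v0 /row_free mxrank0 ltn_eqF.
Qed.

End SpecialLinearAction.

(** * Passage to logarithms and conclusion *)

Lemma log2_natr_le (R : realType) (m e : nat) :
  m <= 2 ^ e -> (log2 (m%:R : R) <= e%:R)%R.
Proof.
have ln2 : (0 < ln (2 : R))%R by rewrite ln_gt0 // ltr1n.
move=> le_m; rewrite /log2 ler_pdivrMr // mulr_natl -lnXn ?ltr0n // -natrX.
(* For [m = 0] the convention [ln 0 = 0] applies. *)
have [->|m_gt0] := posnP m.
  by rewrite ln0 ?lexx // ln_ge0 // ler1n expn_gt0.
by rewrite ler_ln ?ler_nat // posrE ltr0n // expn_gt0.
Qed.

Lemma log2_natr_ge0 (R : realType) (m : nat) : (0 <= log2 (m%:R : R))%R.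
Proof.
have ln2 : (0 < ln (2 : R))%R by rewrite ln_gt0 // ltr1n.
rewrite /log2 divr_ge0 ?(ltW ln2) //; have [->|m_gt0] := posnP m.
  by rewrite ln0.
by rewrite ln_ge0 // ler1n.
Qed.

Theorem theorem2 (R : realType) (F : finFieldType) (n k : nat)
    (S : {set {'GL_n[F]}}) :
  2 < #|F| -> 0 < k -> k < n ->
  (<<S>>%g = SL F n) -> (1%g \in S) -> (S^-1%g = S) ->
  let act := @SL_act F n k in
  let p := pdiv (#|F| - 1) in
  (log2 ((diam (Sch act S))%:R : R) - log2 ((p - 1)%N%:R : R) - 3
     <= (WL (Sch_colour act S))%:R)%R.
Proof.
move=> F_gt2 k_gt0 lt_kn genS S1 SV /=.
have [l /andP[l0 l1]] : exists l : F, (l != 0%R) && (l != 1%R).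
  apply/existsP; apply: contraLR F_gt2; rewrite -leqNgt => /existsPn no.
  apply: leq_trans (_ : #|[set (0 : F)%R; 1%R]| <= 2); last first.
    by rewrite cards2; case: (_ != _).
  apply: subset_leq_card; apply/subsetP=> t _; rewrite !inE.
  by have := no t; rewrite negb_and !negbK.
have [z ez] := scalar_GL n l0.
(* The central group is generated by one scalar matrix of GL, whose determinant may differ from
   1. *)
have cZS : (<[z]> \subset 'C(S))%g.
  rewrite cycle_subG; apply/centP=> s _; apply: val_inj.
  by rewrite [LHS]GL_MxE [RHS]GL_MxE ez scalar_mxC.
have le_diam : diam (Sch (@SL_act F n k) S)
    <= 2 ^ (WL (Sch_colour (@SL_act F n k) S)).+2.
  apply: (diam_le_WL (@SL_act1 F n k) (@SL_actM F n k) cZS S1 SV (cycle_id z)).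
    by move=> y; apply: SL_act_scalar_free ez.
  by move=> x y; rewrite genS; apply: SL_act_trans.
(* The exponent is [WL + 2]; the claim follows from [2 <= 3] and the nonnegativity of the logarithm
   of [p - 1]. *)
have le_log := log2_natr_le R le_diam; rewrite !lerBlDr.
apply: le_trans le_log _; rewrite -addn2 natrD -addrA lerD2l.
by apply: ler_wpDr (log2_natr_ge0 R _) _; rewrite ler_nat.
Qed.
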